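(* Let $S$ be a finite or countably infinite set and let $(X,i,\lambda)$ and $(Y,j,\mu)$ be labeled HDA over $S$. Then they are homotopy bisimilar if and only if they are bisimilar.
   Context: A precubical set $X$: sets $(X_n)_{n\in\mathbb N}$ with face maps $\delta_k^\nu:X_n\to X_{n-1}$ ($n\ge1$, $1\le k\le n$, $\nu\in\{0,1\}$), $\delta_k^\nu\delta_\ell^\mu=\delta_{\ell-1}^\mu\delta_k^\nu$ for $k<\ell$; morphisms commute with face maps. An HDA $i:*\to X$ is a precubical set with distinguished $0$-cube $i$; HDA morphisms preserve it (category $\mathsf{HDA}$). For $S=\{a_1,a_2,\dots\}$ finite or countably infinite, $!S$ has $!S_n=\{(a_{i_1},\dots,a_{i_n})\mid i_1\le\dots\le i_n\}$ and $\delta_k^\nu$ deletes the $k$-th entry (for both $\nu$); its unique $0$-cube is its base point. A labeled HDA over $S$ is an HDA $i:*\to X$ with a precubical morphism $\lambda:X\to\,!S$. Cube path: $(x_1,\dots,x_m)$ with, for each $j<m$, some $k$ with $x_j=\delta_k^0x_{j+1}$ or $x_{j+1}=\delta_k^1x_j$; pointed if $x_1=i$. Path objects: a precubical set $P$ with a sequence $(x_1,\dots,x_m)$ of pairwise distinct elements forming a cube path such that every $x\in P$ equals $\delta_{k_1}^{\nu_1}\cdots\delta_{k_p}^{\nu_p}x_j$ for some $j$, $\nu$'s and a unique $k_1<\dots<k_p$. A cube path extension $f:P\to Q$ (representations $(x_1,\dots,x_m)$, $(y_1,\dots,y_q)$) satisfies $f(x_j)=y_j$ for $j\le m$. $\mathsf{HDP}$: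 subcategory of $\mathsf{HDA}$ of path objects pointed at $x_1$, morphisms generated by isomorphisms and pointed cube path extensions. $f:X\to Y$ in $\mathsf{HDA}$ is open if for all $g:P\to Q$ in $\mathsf{HDP}$ and $p:P\to X$, $q:Q\to Y$ with $f\circ p=q\circ g$ there is $r:Q\to X$ with $r\circ g=p$, $f\circ r=q$. Labeled bisimilarity: a morphism $(Z,k,\zeta)\to(X,i,\lambda)$ of labeled HDA over the same $S$ (identity label component) is a pointed morphism $f:Z\to X$ with $\lambda\circ f=\zeta$; it is open if $f$ is open in $\mathsf{HDA}$; $X,Y$ are bisimilar if there are a labeled HDA $Z$ over $S$ and open such morphisms $Z\to X$, $Z\to Y$. Homotopy: adjacency of $(x_1,\dots,x_m)$, $(y_1,\dots,y_m)$: $x_1=y_1$, $x_m=y_m$, differ at exactly one index $p$, and for some $k<\ell$ (possibly with roles exchanged): (a) $x_{p-1}=\delta_k^0x_p$, $x_p=\delta_\ell^0x_{p+1}$, $y_{p-1}=\delta_{\ell-1}^0y_p$, $y_p=\delta_k^0y_{p+1}$; or (b) $x_p=\delta_k^1x_{p-1}$, $x_{p+1}=\delta_\ell^1x_p$, $y_p=\delta_{\ell-1}^1y_{p-1}$, $y_{p+1}=\delta_k^1y_p$; or (c) $x_p=\delta_k^0\delta_\ell^1y_p$, $y_{p-1}=\delta_k^0y_p$, $y_{p+1}=\delta_\ell^1y_p$; or (d) $x_p=\delta_k^1\delta_\ell^0y_p$, $y_{p-1}=\delta_\ell^0y_p$, $y_{p+1}=\delta_k^1y_p$; $\sim$ =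 reflexive transitive closure. Unfolding $\tilde X$: $\tilde X_n$ = classes $[x_1,\dots,x_m]$ of pointed cube paths with $x_m\in X_n$, base point $[i]$, $\tilde\delta_k^1[x_1,\dots,x_m]=[x_1,\dots,x_m,\delta_k^1x_m]$, $\tilde\delta_k^0[x_1,\dots,x_m]=\{(y_1,\dots,y_p)\mid y_p=\delta_k^0x_m,(y_1,\dots,y_p,x_m)\sim(x_1,\dots,x_m)\}$, projection $\pi_X[x_1,\dots,x_m]=x_m$. A pointed morphism $g$ induces $\tilde g[x_1,\dots,x_m]=[gx_1,\dots,gx_m]$; $\lambda$ induces $\tilde\lambda:\tilde X\to\widetilde{!S}$. Objects of $\mathsf{HDP}$ are higher-dimensional trees (each cube has exactly one homotopy class of pointed cube paths to it), so $\pi_P$ is an isomorphism for them. $\mathsf{HDAh}$: objects HDA, morphisms $X\to Y$ are pointed precubical morphisms $\tilde X\to\tilde Y$. $\mathsf{HDPh}$: objects of $\mathsf{HDP}$, morphisms $h:\tilde P\to\tilde Q$ with $\pi_Q\circ h\circ\pi_P^{-1}\in\mathsf{HDP}$. $f$ in $\mathsf{HDAh}$ is open if it has the right lifting property (all morphisms in $\mathsf{HDAh}$) against $\mathsf{HDPh}$. Labeled homotopy bisimilarity: a morphism $(Z,k,\zeta)\to(X,i,\lambda)$ (identity label component) is a pointed precubical morphism $f:\tilde Z\to\tilde X$ with $\tilde\lambda\circ f=\tilde\zeta$; open if $f$ is open in $\mathsf{HDAh}$; $X,Y$ homotopy bisimilar if there are labeled $Z$ over $S$ and open such morphisms $Z\to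 X$, $Z\to Y$.
   Formalization: Steps of pointed cube paths record the face index k (otherwise the 0-faces of the unfolding are ill-defined); move (b) is corrected to the mirror image of (a); objects of HDP are required to be higher-dimensional trees, which the path-object conditions alone do not imply. *)

(* Defs.v *)
From Stdlib Require Import Relation_Definitions Relation_Operators.
From mathcomp Require Import all_boot boolp zify.

Set Implicit Arguments.
Unset Strict Implicit.
Unset Printing Implicit Defensive.

(** * Precubical sets and HDA *)

(* Face indices are 0-based: the faces of an (n+1)-cube are indexed by 'I_n.+1.
   [exch k l k' l'] says that k < l and that k', l' are the indices k, l - 1
   used one dimension lower, as in  delta_k delta_l = delta_(l-1) delta_k. *)
Definition exch n (k l : 'I_n.+2) (k' l' : 'I_n.+1) : Prop :=
  [/\ k < l, k' = k :> nat & l' = l.-1 :> nat].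

Record precubical := Precubical {
  cube :> nat -> Type;
  face : forall n, 'I_n.+1 -> bool -> cube n.+1 -> cube n;
  faceC : forall n (k l : 'I_n.+2) (k' l' : 'I_n.+1) nu mu (x : cube n.+2),
    exch k l k' l' -> face k' nu (face l mu x) = face l' mu (face k nu x)
}.
Arguments face {p n}.

Record pmor (X Y : precubical) := Pmor {
  pmor_fun :> forall n, X n -> Y n;
  pmorP : forall n (k : 'I_n.+1) nu (x : X n.+1),
    pmor_fun (face k nu x) = face k nu (pmor_fun x)
}.

Record hda := Hda { hda_pc :> precubical; base : hda_pc 0 }.
Arguments base : clear implicits.

Record hmor (X Y : hda) := Hmor {
  hmor_pmor :> pmor X Y;
  hmor_base : hmor_pmor 0 (base X) = base Y
}.

Lemma hcomp_subproof (X Y Z : hda) (g : hmor Y Z) (f : hmor X Y) n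
    (k : 'I_n.+1) nu (x : X n.+1) :
  g n (f n (face k nu x)) = face k nu (g n.+1 (f n.+1 x)).
Proof. by rewrite !pmorP. Qed.

Lemma hcomp_base (X Y Z : hda) (g : hmor Y Z) (f : hmor X Y) :
  g 0 (f 0 (base X)) = base Z.
Proof. by rewrite !hmor_base. Qed.

Definition hcomp (X Y Z : hda) (g : hmor Y Z) (f : hmor X Y) : hmor X Z :=
  @Hmor X Z (@Pmor X Z (fun n x => g n (f n x)) (@hcomp_subproof X Y Z g f))
    (hcomp_base g f).

Definition heq (X Y : hda) (f g : hmor X Y) : Prop :=
  forall n (x : X n), f n x = g n x.

Definition hinverse (X Y : hda) (f : hmor X Y) (g : hmor Y X) : Prop :=
  (forall n (x : X n), g n (f n x) = x) /\ (forall n (y : Y n), f n (g n y) = y).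

Definition hiso (X Y : hda) (f : hmor X Y) : Prop :=
  exists g : hmor Y X, hinverse f g.

(** * The precubical set !S *)

(* The enumeration a_1, a_2, ... of S is the one given by [pickle]. *)
Definition idx_le (S : countType) : rel S := fun a b => pickle a <= pickle b.
Arguments idx_le : clear implicits.

Definition bang_cube (S : countType) (n : nat) : Type :=
  {t : n.-tuple S | sorted (idx_le S) t}.

Definition del_tuple (T : Type) n (k : 'I_n.+1) (t : n.+1.-tuple T) : n.-tuple T :=
  [tuple tnth t (lift k j) | j < n].

Lemma del_sorted (S : countType) n (k : 'I_n.+1) (t : n.+1.-tuple S) :
  sorted (idx_le S) t -> sorted (idx_le S) (del_tuple k t).
Proof.
move=> st; pose r : rel 'I_n := fun i j => (i <= j)%N.
apply: (@homo_sorted _ _ (fun j => tnth t (lift k j)) r) => [i j ij|].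
  have x0 : S := tnth t ord0; rewrite !(tnth_nth x0).
  apply: (@sorted_leq_nth _ (idx_le S)) => //; rewrite ?inE ?size_tuple //.
  - by move=> a b c; apply: leq_trans.
  - by move=> a; apply: leqnn.
  - by rewrite /= leq_bump2.
have -> : sorted r (enum 'I_n) = sorted leq (map val (enum 'I_n)).
  by rewrite sorted_map.
by rewrite val_enum_ord iota_sorted.
Qed.

Definition bang_face (S : countType) n (k : 'I_n.+1) (nu : bool)
    (t : bang_cube S n.+1) : bang_cube S n :=
  exist _ (del_tuple k (sval t)) (del_sorted k (svalP t)).

Lemma bang_faceC (S : countType) n (k l : 'I_n.+2) (k' l' : 'I_n.+1)
    (nu mu : bool) (t : bang_cube S n.+2) :
  exch k l k' l' ->
  bang_face k' nu (bang_face l mu t) = bang_face l' mu (bang_face k nu t).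
Proof.
move=> [kl ek el]; apply: val_inj; apply: eq_from_tnth => j /=.
rewrite !tnth_mktuple; congr tnth; apply: val_inj => /=.
by rewrite /bump; lia.
Qed.

Definition bang_pc (S : countType) : precubical :=
  @Precubical (bang_cube S) (@bang_face S) (@bang_faceC S).

Definition bang (S : countType) : hda :=
  @Hda (bang_pc S) (exist _ [tuple] isT).

Lemma bang0 (S : countType) (x y : bang S 0) : x = y.
Proof. by apply: val_inj => /=; rewrite (tuple0 (sval x)) (tuple0 (sval y)). Qed.

Record lhda (S : countType) := Lhda { lhda_hda :> hda; label : pmor lhda_hda (bang S) }.

Definition hlabel (S : countType) (X : lhda S) : hmor X (bang S) :=
  @Hmor X (bang S) (label X) (bang0 _ _).

(** * Homotopy of pointed cube paths *)

(* Pointed cube paths ending in x, extended one step at a time.  A step carries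
   the index k of the face it uses: a path is i, k_1, x_2, ..., k_(m-1), x_m.
   Without the indices the 0-faces of the unfolding are not well defined when a
   cube has coinciding faces: for a square x with delta_1^1 x = delta_2^1 x = f
   and distinct 0-faces e, e', the bare sequences (v,e,w,f) and (v,e',w,f) would
   be homotopic although (v,e,w) and (v,e',w) are not. *)
Inductive cpath (X : hda) : forall n, X n -> Type :=
| cp_base : cpath (base X)
| cp_up n (k : 'I_n.+1) (y : X n) (x : X n.+1) :
    y = face k false x -> cpath y -> cpath x
| cp_down n (k : 'I_n.+1) (x : X n.+1) (y : X n) :
    y = face k true x -> cpath x -> cpath y.
Arguments cp_base {X}.
Arguments cp_up {X n} k {y x}.
Arguments cp_down {X n} k {x y}.

(* The four elementary moves, for k < l.  They act on the last three cubes
   x_(p-1), x_p, x_(p+1) and are closed under extending both paths by the same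
   steps.  In the first two the middle cubes may coincide, the paths then
   differing only in their indices. *)
Inductive elem_adj (X : hda) : forall n (x : X n), cpath x -> cpath x -> Prop :=
| adj_a n k l k' l' (w : X n) (x y : X n.+1) (z : X n.+2)
    (xk : w = face k' false x) (zl : x = face l false z)
    (yl : w = face l' false y) (zk : y = face k false z) (c : cpath w) :
    exch k l k' l' ->
    elem_adj (cp_up l zl (cp_up k' xk c)) (cp_up k zk (cp_up l' yl c))
| adj_b n k l k' l' (w : X n.+2) (x y : X n.+1) (z : X n)
    (wl : x = face l true w) (xk : z = face k' true x)
    (wk : y = face k true w) (yl : z = face l' true y) (c : cpath w) :
    exch k l k' l' ->
    elem_adj (cp_down k' xk (cp_down l wl c)) (cp_down l' yl (cp_down k wk c))
| adj_c n k l k' l' (w z : X n.+1) (x : X n) (y : X n.+2)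
    (wl : x = face l' true w) (zk : x = face k' false z)
    (yk : w = face k false y) (yl : z = face l true y) (c : cpath w) :
    exch k l k' l' ->
    elem_adj (cp_up k' zk (cp_down l' wl c)) (cp_down l yl (cp_up k yk c))
| adj_d n k l k' l' (w z : X n.+1) (x : X n) (y : X n.+2)
    (wk : x = face k' true w) (zl : x = face l' false z)
    (yl : w = face l false y) (yk : z = face k true y) (c : cpath w) :
    exch k l k' l' ->
    elem_adj (cp_up l' zl (cp_down k' wk c)) (cp_down k yk (cp_up l yl c))
| adj_up n k (y : X n) (x : X n.+1) (e : y = face k false x) (c d : cpath y) :
    elem_adj c d -> elem_adj (cp_up k e c) (cp_up k e d)
| adj_down n k (x : X n.+1) (y : X n) (e : y = face k true x) (c d : cpath x) :
    elem_adj c d -> elem_adj (cp_down k e c) (cp_down k e d).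

Definition adjacent (X : hda) n (x : X n) (c d : cpath x) : Prop :=
  elem_adj c d \/ elem_adj d c.

Definition homotopic (X : hda) n (x : X n) : relation (cpath x) :=
  clos_refl_trans _ (@adjacent X n x).

Section HomotopyTheory.
Variable X : hda.
Implicit Types n : nat.

Lemma hom_refl n (x : X n) (c : cpath x) : homotopic c c.
Proof. exact: rt_refl. Qed.

Lemma hom_trans n (x : X n) (c d e : cpath x) :
  homotopic c d -> homotopic d e -> homotopic c e.
Proof. exact: rt_trans. Qed.

Lemma hom_sym n (x : X n) (c d : cpath x) : homotopic c d -> homotopic d c.
Proof.
elim=> [c1 d1 []|c1|c1 d1 e1 _ h1 _ h2].
- by move=> h; apply: rt_step; right.
- by move=> h; apply: rt_step; left.
- exact: rt_refl.
- exact: rt_trans h2 h1.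
Qed.

Lemma hom_adj n (x : X n) (c d : cpath x) : elem_adj c d -> homotopic c d.
Proof. by move=> h; apply: rt_step; left. Qed.

Lemma hom_up n (k : 'I_n.+1) (y : X n) (x : X n.+1) (e : y = face k false x)
    (c d : cpath y) : homotopic c d -> homotopic (cp_up k e c) (cp_up k e d).
Proof.
elim=> [c1 d1 [h|h]|c1|c1 d1 e1 _ h1 _ h2].
- by apply: rt_step; left; apply: adj_up.
- by apply: rt_step; right; apply: adj_up.
- exact: rt_refl.
- exact: rt_trans h1 h2.
Qed.

Lemma hom_down n (k : 'I_n.+1) (x : X n.+1) (y : X n) (e : y = face k true x)
    (c d : cpath x) : homotopic c d -> homotopic (cp_down k e c) (cp_down k e d).
Proof.
elim=> [c1 d1 [h|h]|c1|c1 d1 e1 _ h1 _ h2].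
- by apply: rt_step; left; apply: adj_down.
- by apply: rt_step; right; apply: adj_down.
- exact: rt_refl.
- exact: rt_trans h1 h2.
Qed.

(* [swap] is the symmetric form of [exch], for k != l. *)
Definition swap n (k l : 'I_n.+2) (k' l' : 'I_n.+1) : Prop :=
  k = bump l k' :> nat /\ l = bump k l' :> nat.

Ltac swap_lia :=
  repeat match goal with H : swap _ _ _ _ |- _ => unfold swap, bump in H; simpl in H end;
  unfold swap, bump in *; simpl; unfold bump; lia.

Lemma exch_swap n (k l : 'I_n.+2) k' l' : exch k l k' l' -> swap k l k' l'.
Proof. by move=> [kl ek el]; rewrite /swap /bump; lia. Qed.

Lemma swap_sym n (k l : 'I_n.+2) k' l' : swap k l k' l' -> swap l k l' k'.
Proof. by case. Qed.

Lemma swap_exch n (k l : 'I_n.+2) k' l' :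
  swap k l k' l' -> exch k l k' l' \/ exch l k l' k'.
Proof.
rewrite /swap /bump => -[h1 h2]; case: (ltnP k l) => kl; [left|right]; split; lia.
Qed.

Lemma swap_ex n (k l : 'I_n.+2) : k != l -> {k' & {l' | swap k l k' l'}}.
Proof.
move=> kl; have nkl : (k : nat) != l by [].
have hk := ltn_ord k; have hl := ltn_ord l.
have k'P : unbump l k < n.+1 by rewrite /unbump; lia.
have l'P : unbump k l < n.+1 by rewrite /unbump; lia.
exists (Ordinal k'P), (Ordinal l'P).
by rewrite /swap /= /bump /unbump; lia.
Qed.

Lemma swap_inj n (k l : 'I_n.+2) k1 l1 k2 l2 :
  swap k l k1 l1 -> swap k l k2 l2 -> k1 = k2 /\ l1 = l2.
Proof.
rewrite /swap /bump => -[h1 h2] [h3 h4].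
by split; apply: val_inj => /=; lia.
Qed.

Lemma swap_lift n (l : 'I_n.+2) (k' : 'I_n.+1) :
  {l' | swap (lift l k') l k' l'}.
Proof.
have nkl : lift l k' != l by rewrite eq_sym neq_lift.
have [k1 [l1 s]] := swap_ex nkl; exists l1.
suff E : k1 = k' by subst k1.
by apply: val_inj; case: s => /=; rewrite /bump; lia.
Qed.

Lemma face_swap n (k l : 'I_n.+2) k' l' nu mu (x : X n.+2) :
  swap k l k' l' -> face k' nu (face l mu x) = face l' mu (face k nu x).
Proof. by move/swap_exch => [h|h]; [exact: faceC|rewrite (faceC _ _ _ h)]. Qed.

Lemma hom_uu n k l k' l' (w : X n) (x y : X n.+1) (z : X n.+2)
    (xk : w = face k' false x) (zl : x = face l false z)
    (yl : w = face l' false y) (zk : y = face k false z) (c : cpath w) :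
  swap k l k' l' ->
  homotopic (cp_up l zl (cp_up k' xk c)) (cp_up k zk (cp_up l' yl c)).
Proof.
by case/swap_exch => h; [|apply: hom_sym]; apply: hom_adj; apply: adj_a.
Qed.

Lemma hom_dd n k l k' l' (w : X n.+2) (x y : X n.+1) (z : X n)
    (wl : x = face l true w) (xk : z = face k' true x)
    (wk : y = face k true w) (yl : z = face l' true y) (c : cpath w) :
  swap k l k' l' ->
  homotopic (cp_down k' xk (cp_down l wl c)) (cp_down l' yl (cp_down k wk c)).
Proof.
by case/swap_exch => h; [|apply: hom_sym]; apply: hom_adj; apply: adj_b.
Qed.

Lemma hom_ud n k l k' l' (w z : X n.+1) (x : X n) (y : X n.+2)
    (wl : x = face l' true w) (zk : x = face k' false z)
    (yk : w = face k false y) (yl : z = face l true y) (c : cpath w) :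
  swap k l k' l' ->
  homotopic (cp_up k' zk (cp_down l' wl c)) (cp_down l yl (cp_up k yk c)).
Proof.
by case/swap_exch => h; apply: hom_adj; [apply: adj_c|apply: adj_d].
Qed.

Definition low_type n : X n -> Type :=
  match n return X n -> Type with
  | 0 => fun _ => unit
  | m.+1 => fun x => forall k : 'I_m.+1, cpath (face k false x)
  end.

Lemma low_up_subproof n (k : 'I_n.+1) (y : X n) (x : X n.+1) :
  y = face k false x -> cpath y -> low_type y ->
  forall j : 'I_n.+1, cpath (face j false x).
Proof.
move=> e c IH j; case: (eq_comparable j k) => [->|/eqP jk]; first by rewrite -e.
case: n k y x e c IH j jk => [|n] k y x e c IH j jk.
  by exfalso; move: jk; rewrite (ord1 j) (ord1 k) eqxx.
case: (swap_ex jk) => j' [k' s].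
by apply: (cp_up k' _ (IH j')); rewrite e; apply: face_swap.
Defined.

Lemma low_down_subproof n (k : 'I_n.+1) (x : X n.+1) (y : X n) :
  y = face k true x -> low_type x -> low_type y.
Proof.
case: n k x y => [|n] k x y e /= IH; first exact: tt.
move=> j; case: (swap_lift k j) => k' s.
by apply: (cp_down k' _ (IH (lift k j))); rewrite e; apply: face_swap.
Defined.

(* [low c k] is a path to the k-th 0-face of x through which c can be deformed. *)
Fixpoint low_gen n (x : X n) (c : cpath x) : low_type x :=
  match c in @cpath _ n x return low_type x with
  | cp_base => tt
  | cp_up _ _ _ _ e c' => low_up_subproof e c' (low_gen c')
  | cp_down _ _ _ _ e c' => low_down_subproof e (low_gen c')
  end.

Definition low n (x : X n.+1) (c : cpath x) (k : 'I_n.+1) : cpath (face k false x) :=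
  low_gen c k.

Lemma low_up_eq n (k : 'I_n.+1) (x : X n.+1) (e : face k false x = face k false x)
    (c : cpath (face k false x)) : low (cp_up k e c) k = c.
Proof.
rewrite /low /= /low_up_subproof; case: (eq_comparable k k) => [ek|//].
by rewrite (Prop_irrelevance ek erefl) (Prop_irrelevance e erefl).
Qed.

Lemma low_up_ne n (k j : 'I_n.+2) j' k' (y : X n.+1) (x : X n.+2)
    (e : y = face k false x) (e' : face j' false y = face k' false (face j false x))
    (c : cpath y) :
  swap j k j' k' -> low (cp_up k e c) j = cp_up k' e' (low c j').
Proof.
move=> s; rewrite /low /= /low_up_subproof; case: (eq_comparable j k) => [ejk|njk].
  by exfalso; case: s; rewrite ejk /bump; lia.
case: (swap_ex _) => j1 [k1 s1].
have [ej ek] := swap_inj s s1; subst j1 k1.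
exact: (congr1 (fun E => cp_up k' E (low_gen c j')) (Prop_irrelevance _ _)).
Qed.

Lemma low_downE n (k j : 'I_n.+2) j' k' (x : X n.+2) (y : X n.+1)
    (e : y = face k true x) (e' : face j' false y = face k' true (face j false x))
    (c : cpath x) :
  swap j k j' k' -> low (cp_down k e c) j' = cp_down k' e' (low c j).
Proof.
move=> s; have ej : j = lift k j' by apply: val_inj; case: s.
subst j; rewrite /low /= /low_down_subproof.
case: (swap_lift _ _) => k1 s1; have [_ ek] := swap_inj s s1; subst k1.
exact: (congr1 (fun E => cp_down k' E (low_gen c (lift k j'))) (Prop_irrelevance _ _)).
Qed.

Lemma low_split n (x : X n) (c : cpath x) :
  match n return forall x : X n, cpath x -> Prop with
  | 0 => fun _ _ => True
  | m.+1 => fun x c => forall (k : 'I_m.+1) (e : face k false x = face k false x),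
      homotopic (cp_up k e (low c k)) c
  end x c.
Proof.
elim: c => {n x} [|n k y x e c IH|n k x y e c IH] //=.
- move=> j ej; case: (eqVneq j k) => [ejk|njk].
    subst j y; rewrite low_up_eq (Prop_irrelevance ej erefl); exact: hom_refl.
  case: n k y x e c IH j ej njk => [|n] k y x e c IH j ej njk.
    by exfalso; move: njk; rewrite (ord1 j) (ord1 k) eqxx.
  have [j' [k' s]] := swap_ex njk.
  have e' : face j' false y = face k' false (face j false x).
    by rewrite e; apply: face_swap.
  rewrite (low_up_ne e e' c s).
  apply: hom_trans (hom_up e (IH j' erefl)).
  exact: hom_uu (swap_sym s).
- case: n k x y e c IH => [|n] k x y e c IH //= j' ej.
  have [k' s] := swap_lift k j'; set j := lift k j' in s.
  have e' : face j' false y = face k' true (face j false x).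
    by rewrite e; apply: face_swap.
  rewrite (low_downE e e' c s).
  apply: hom_trans (hom_down e (IH j erefl)).
  exact: hom_ud s.
Qed.

Lemma low_split' n (x : X n.+1) (c : cpath x) (k : 'I_n.+1) :
  homotopic (cp_up k erefl (low c k)) c.
Proof. exact: (low_split c). Qed.

Lemma low_uu_eq n k l k' l' (w : X n) (x y : X n.+1) (z : X n.+2)
    (xk : w = face k' false x) (zl : x = face l false z)
    (yl : w = face l' false y) (zk : y = face k false z) (c : cpath w) :
  swap k l k' l' ->
  low (cp_up l zl (cp_up k' xk c)) l = low (cp_up k zk (cp_up l' yl c)) l.
Proof.
move=> s; subst x; rewrite low_up_eq.
move: xk; subst w => xk.
by rewrite (low_up_ne zk xk _ (swap_sym s)) low_up_eq.
Qed.

Lemma low_uu n k l k' l' (w : X n) (x y : X n.+1) (z : X n.+2)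
    (xk : w = face k' false x) (zl : x = face l false z)
    (yl : w = face l' false y) (zk : y = face k false z) (c : cpath w) j :
  swap k l k' l' ->
  homotopic (low (cp_up l zl (cp_up k' xk c)) j)
    (low (cp_up k zk (cp_up l' yl c)) j).
Proof.
move=> s; case: (eqVneq j l) => [->|njl].
  by rewrite (low_uu_eq xk zl yl zk c s); apply: hom_refl.
case: (eqVneq j k) => [->|njk].
  by rewrite (low_uu_eq yl zk xk zl c (swap_sym s)); apply: hom_refl.
case: n k l k' l' w x y z xk zl yl zk c j s njl njk
  => [|n] k l k' l' w x y z xk zl yl zk c j s njl njk.
  exfalso; move: (ltn_ord j) (ltn_ord k) (ltn_ord l) njl njk.
  by case: s; rewrite -!val_eqE /= /bump; lia.
have [jl [l1 sl]] := swap_ex njl; have [jk [k1 sk]] := swap_ex njk.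
have n1 : jl != k'.
  apply/eqP => E; move/eqP: njk; apply; apply: val_inj; subst k'; swap_lia.
have n2 : jk != l'.
  apply/eqP => E; move/eqP: njl; apply; apply: val_inj; subst l'; swap_lia.
have [j2 [k2 s1]] := swap_ex n1; have [j3 [l2 s2]] := swap_ex n2.
have ej : j3 = j2.
  by apply: val_inj; swap_lia.
subst j3.
have s12 : swap k1 l1 k2 l2.
  by split; swap_lia.
have a1 : face jl false x = face l1 false (face j false z).
  by rewrite zl; apply: face_swap.
have a2 : face j2 false w = face k2 false (face jl false x).
  by rewrite xk; apply: face_swap.
have b1 : face jk false y = face k1 false (face j false z).
  by rewrite zk; apply: face_swap.
have b2 : face j2 false w = face l2 false (face jk false y).
  by rewrite yl; apply: face_swap.
rewrite (low_up_ne zl a1 _ sl) (low_up_ne xk a2 _ s1).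
rewrite (low_up_ne zk b1 _ sk) (low_up_ne yl b2 _ s2).
exact: hom_uu.
Qed.

Lemma low_dd n k l k' l' (w : X n.+3) (x y : X n.+2) (z : X n.+1)
    (wl : x = face l true w) (xk : z = face k' true x)
    (wk : y = face k true w) (yl : z = face l' true y) (c : cpath w) j :
  swap k l k' l' ->
  homotopic (low (cp_down k' xk (cp_down l wl c)) j)
    (low (cp_down l' yl (cp_down k wk c)) j).
Proof.
move=> s.
have [k2 s1] := swap_lift k' j; have [l2 s2] := swap_lift l' j.
have [l1 sl] := swap_lift l (lift k' j).
have [k1 sk] := swap_lift k (lift l' j).
have ej : lift k (lift l' j) = lift l (lift k' j).
  by apply: val_inj; swap_lia.
rewrite ej in sk.
have s12 : swap k1 l1 k2 l2.
  by split; swap_lia.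
have a1 : face (lift k' j) false x = face l1 true (face (lift l (lift k' j)) false w).
  by rewrite wl; apply: face_swap.
have a2 : face j false z = face k2 true (face (lift k' j) false x).
  by rewrite xk; apply: face_swap.
have b1 : face (lift l' j) false y = face k1 true (face (lift l (lift k' j)) false w).
  by rewrite wk; apply: face_swap.
have b2 : face j false z = face l2 true (face (lift l' j) false y).
  by rewrite yl; apply: face_swap.
rewrite (low_downE xk a2 _ s1) (low_downE wl a1 _ sl).
rewrite (low_downE yl b2 _ s2) (low_downE wk b1 _ sk).
exact: hom_dd.
Qed.

Lemma low_ud n k l k' l' (w z : X n.+1) (x : X n) (y : X n.+2)
    (wl : x = face l' true w) (zk : x = face k' false z)
    (yk : w = face k false y) (yl : z = face l true y) (c : cpath w) j :
  swap k l k' l' ->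
  homotopic (low (cp_up k' zk (cp_down l' wl c)) j)
    (low (cp_down l yl (cp_up k yk c)) j).
Proof.
move=> s; case: (eqVneq j k') => [->|njk].
  move: wl; subst x => wl; rewrite low_up_eq.
  move: wl; subst w => wl.
  by rewrite (low_downE yl wl _ s) low_up_eq; apply: hom_refl.
case: n k l k' l' w z x y wl zk yk yl c j s njk
  => [|n] k l k' l' w z x y wl zk yk yl c j s njk.
  by exfalso; move: njk; rewrite (ord1 j) (ord1 k') eqxx.
have [j1 [k1 s1]] := swap_ex njk.
have [l1 sl] := swap_lift l j; set J := lift l j in sl.
have EJ : J = bump l j :> nat by [].
have nJk : J != k.
  apply/eqP => E; move/eqP: njk; apply; apply: val_inj.
  by rewrite E in EJ; swap_lia.
have [jk [k2 sk]] := swap_ex nJk.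
have [l2 s2] := swap_lift l' j1.
have ej : lift l' j1 = jk.
  by apply: val_inj; swap_lia.
rewrite ej in s2.
have s12 : swap k2 l1 k1 l2.
  by split; swap_lia.
have a1 : face j1 false x = face k1 false (face j false z).
  by rewrite zk; apply: face_swap.
have a2 : face j1 false x = face l2 true (face jk false w).
  by rewrite wl; apply: face_swap.
have b1 : face j false z = face l1 true (face J false y).
  by rewrite yl; apply: face_swap.
have b2 : face jk false w = face k2 false (face J false y).
  by rewrite yk; apply: face_swap.
rewrite (low_up_ne zk a1 _ s1) (low_downE wl a2 _ s2).
rewrite (low_downE yl b1 _ sl) (low_up_ne yk b2 _ sk).
exact: hom_ud.
Qed.

Lemma low_adj n (x : X n) (c d : cpath x) : elem_adj c d ->
  match n return forall x : X n, cpath x -> cpath x -> Prop with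
  | 0 => fun _ _ _ => True
  | m.+1 => fun x c d => forall k, homotopic (low c k) (low d k)
  end x c d.
Proof.
elim=> {n x c d}.
- by move=> n k l k' l' w x y z xk zl yl zk c /exch_swap s j; apply: low_uu.
- case=> [//|n] k l k' l' w x y z wl xk wk yl c /exch_swap s j; exact: low_dd.
- move=> n k l k' l' w z x y wl zk yk yl c /exch_swap s j; exact: low_ud.
- move=> n k l k' l' w z x y wk zl yl yk c /exch_swap s j.
  exact: (low_ud wk zl yl yk c j (swap_sym s)).
- move=> n k y x e c d cd IH j; case: (eqVneq j k) => [->|njk].
    by subst y; rewrite !low_up_eq; apply: hom_adj.
  case: n k y x e c d cd IH j njk => [|n] k y x e c d cd IH j njk.
    by exfalso; move: njk; rewrite (ord1 j) (ord1 k) eqxx.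
  have [j1 [k1 s]] := swap_ex njk.
  have a : face j1 false y = face k1 false (face j false x).
    by rewrite e; apply: face_swap.
  by rewrite !(low_up_ne e a _ s); apply: hom_up.
- case=> [//|n] k x y e c d cd IH j.
  have [k1 s] := swap_lift k j.
  have a : face j false y = face k1 true (face (lift k j) false x).
    by rewrite e; apply: face_swap.
  by rewrite !(low_downE e a _ s); apply: hom_down.
Qed.

Lemma low_hom n (x : X n.+1) (c d : cpath x) k :
  homotopic c d -> homotopic (low c k) (low d k).
Proof.
elim=> [c1 d1 [h|h]|c1|c1 d1 e1 _ h1 _ h2].
- exact: (low_adj h).
- exact/hom_sym/(low_adj h).
- exact: hom_refl.
- exact: hom_trans h1 h2.
Qed.

Lemma hom_lowP n (x : X n.+1) (c : cpath x) k (d : cpath (face k false x)) :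
  homotopic (cp_up k erefl d) c <-> homotopic (low c k) d.
Proof.
split=> [/(low_hom k)|h]; first by rewrite low_up_eq; apply: hom_sym.
apply: hom_trans (low_split' c k); exact/hom_up/hom_sym.
Qed.

End HomotopyTheory.

(** * Unfoldings *)

Section Unfolding.
Variable X : hda.

Lemma hom_classE n (x : X n) (c d : cpath x) :
  homotopic c = homotopic d <-> homotopic c d.
Proof.
split=> [->|cd]; first exact: hom_refl.
apply/predeqP => e; split; apply: hom_trans => //; exact: hom_sym.
Qed.

(* An n-cube of the unfolding: a homotopy class of pointed cube paths, together
   with the n-cube x_m in which they all end. *)
Record ucube n := UCube {
  uend : X n;
  ucls : cpath uend -> Prop;
  uclsP : exists c, ucls = homotopic c
}.

Definition uclass n (x : X n) (c : cpath x) : ucube n :=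
  @UCube n x (homotopic c) (ex_intro _ c erefl).

Lemma uface0P n (k : 'I_n.+1) (u : ucube n.+1) :
  exists c, (fun d : cpath (face k false (uend u)) => ucls (cp_up k erefl d))
            = homotopic c.
Proof.
have [c ->] := uclsP u; exists (low c k); apply/predeqP => d; split=> h.
  by apply/hom_lowP/hom_sym.
by apply/hom_sym/hom_lowP.
Qed.

Lemma uface1P n (k : 'I_n.+1) (u : ucube n.+1) :
  exists c, (fun d : cpath (face k true (uend u)) =>
               exists2 c', ucls c' & homotopic (cp_down k erefl c') d)
            = homotopic c.
Proof.
have [c ->] := uclsP u; exists (cp_down k erefl c); apply/predeqP => d; split.
  by move=> [c' cc']; apply: hom_trans; apply: hom_down.
by exists c => //; apply: hom_refl.
Qed.

Definition uface n (k : 'I_n.+1) (nu : bool) (u : ucube n.+1) : ucube n :=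
  if nu then UCube (uface1P k u) else UCube (uface0P k u).

Lemma ucube_eq n (x : X n) (C D : cpath x -> Prop) hC hD :
  C = D -> @UCube n x C hC = @UCube n x D hD.
Proof. by move=> E; subst D; rewrite (Prop_irrelevance hC hD). Qed.

Lemma uclass_ex n (u : ucube n) : exists c : cpath (uend u), u = uclass c.
Proof.
by case: u => x C hC; have [c E] := hC; exists c; apply: ucube_eq.
Qed.

Lemma uclass_hom n (x : X n) (c d : cpath x) :
  homotopic c d -> uclass c = uclass d.
Proof. by move=> cd; apply/ucube_eq/hom_classE. Qed.

Lemma uclass_down n (k : 'I_n.+1) (x : X n.+1) (y : X n) (e : y = face k true x)
    (c : cpath x) : uface k true (uclass c) = uclass (cp_down k e c).
Proof.
subst y; apply: ucube_eq; apply/predeqP => d; split.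
  by move=> [c' cc']; apply: hom_trans; apply: hom_down.
by exists c => //; apply: hom_refl.
Qed.

Lemma uclass_up n (k : 'I_n.+1) (y : X n) (x : X n.+1) (e : y = face k false x)
    (c : cpath y) : uface k false (uclass (cp_up k e c)) = uclass c.
Proof.
subst y; apply: ucube_eq; apply/predeqP => d; split=> [h|h].
  by have /hom_lowP := hom_sym h; rewrite low_up_eq.
exact: hom_up.
Qed.

Lemma uclass_up_ex n (k : 'I_n.+1) (u : ucube n.+1) :
  exists c : cpath (face k false (uend u)), u = uclass (cp_up k erefl c).
Proof.
have [c E] := uclass_ex u; exists (low c k); rewrite {1}E.
exact/uclass_hom/hom_sym/low_split'.
Qed.

Lemma ufaceC n (k l : 'I_n.+2) (k' l' : 'I_n.+1) nu mu (u : ucube n.+2) :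
  exch k l k' l' -> uface k' nu (uface l mu u) = uface l' mu (uface k nu u).
Proof.
move=> h; have fC nu' mu' := @faceC X n k l k' l' nu' mu' (uend u) h.
case: nu mu => -[].
- have [c ->] := uclass_ex u; rewrite [uface l _ _](uclass_down erefl).
  rewrite [uface k _ _](uclass_down erefl).
  rewrite [LHS](uclass_down erefl) [RHS](uclass_down (fC _ _)).
  exact/uclass_hom/hom_adj/adj_b.
- have [c ->] := uclass_up_ex l u; rewrite (uclass_up erefl) !(uclass_down erefl).
  rewrite -(uclass_up (fC true false)); congr uface.
  exact/uclass_hom/hom_adj/adj_d.
- have [c ->] := uclass_up_ex k u; rewrite (uclass_up erefl) !(uclass_down erefl).
  apply: esym; rewrite -(uclass_up (esym (fC false true))); congr uface.
  exact/uclass_hom/hom_adj/adj_c.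
- have [c ->] := uclass_ex u; set d := low (low c l) k'.
  have -> : uclass c = uclass (cp_up l erefl (cp_up k' erefl d)).
    apply/uclass_hom/hom_sym; apply: hom_trans (low_split' c l).
    exact/hom_up/low_split'.
  rewrite !(uclass_up erefl); apply: esym.
  have -> : uclass (cp_up l erefl (cp_up k' erefl d))
      = uclass (cp_up k erefl (cp_up l' (fC false false) d)).
    exact/uclass_hom/hom_adj/adj_a.
  by rewrite (uclass_up erefl) uclass_up.
Qed.

Definition unfold_pc : precubical := @Precubical ucube uface ufaceC.

Definition unfold : hda := @Hda unfold_pc (uclass cp_base).

Lemma uend_face n (k : 'I_n.+1) nu (u : ucube n.+1) :
  uend (uface k nu u) = face k nu (uend u).
Proof. by case: nu. Qed.

Definition proj : hmor unfold X :=
  @Hmor unfold X (@Pmor unfold X uend uend_face) erefl.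

End Unfolding.
Arguments uface {X n}.

Section UnfoldMap.
Variables (X Y : hda) (g : hmor X Y).

Lemma map_step n (k : 'I_n.+1) nu (x : X n.+1) (y : X n) :
  y = face k nu x -> g n y = face k nu (g n.+1 x).
Proof. by move=> ->; rewrite pmorP. Qed.

Fixpoint map_cpath n (x : X n) (c : cpath x) : cpath (g n x) :=
  match c in @cpath _ n x return cpath (g n x) with
  | cp_base => eq_rect_r (@cpath Y 0) cp_base (hmor_base g)
  | cp_up _ k _ _ e c' => cp_up k (map_step e) (map_cpath c')
  | cp_down _ k _ _ e c' => cp_down k (map_step e) (map_cpath c')
  end.

Lemma map_adj n (x : X n) (c d : cpath x) :
  elem_adj c d -> elem_adj (map_cpath c) (map_cpath d).
Proof.
elim=> {n x c d}; intros.
- exact: adj_a.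
- exact: adj_b.
- exact: adj_c.
- exact: adj_d.
- exact: adj_up.
- exact: adj_down.
Qed.

Lemma map_hom n (x : X n) (c d : cpath x) :
  homotopic c d -> homotopic (map_cpath c) (map_cpath d).
Proof.
elim=> [c1 d1 [h|h]|c1|c1 d1 e1 _ h1 _ h2].
- exact/hom_adj/map_adj.
- exact/hom_sym/hom_adj/map_adj.
- exact: hom_refl.
- exact: hom_trans h1 h2.
Qed.

Lemma umapP n (u : ucube X n) :
  exists c, (fun d : cpath (g n (uend u)) =>
               exists2 c', ucls c' & homotopic (map_cpath c') d)
            = homotopic c.
Proof.
have [c ->] := uclsP u; exists (map_cpath c); apply/predeqP => d; split.
  by move=> [c' cc']; apply: hom_trans; apply: map_hom.
by exists c => //; apply: hom_refl.
Qed.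

Definition umap n (u : ucube X n) : ucube Y n := UCube (umapP u).

Lemma umap_class n (x : X n) (c : cpath x) :
  umap (uclass c) = uclass (map_cpath c).
Proof.
apply: ucube_eq; apply/predeqP => d; split.
  by move=> [c' cc']; apply: hom_trans; apply: map_hom.
by exists c => //; apply: hom_refl.
Qed.

Lemma umap_face n (k : 'I_n.+1) nu (u : ucube X n.+1) :
  umap (uface k nu u) = uface k nu (umap u).
Proof.
case: nu.
  have [c ->] := uclass_ex u.
  by rewrite (uclass_down erefl) !umap_class [map_cpath (cp_down _ _ _)]/= -uclass_down.
have [c ->] := uclass_up_ex k u.
by rewrite uclass_up !umap_class [map_cpath (cp_up _ _ _)]/= uclass_up.
Qed.

Lemma umap_base : umap (uclass (@cp_base X)) = uclass (@cp_base Y).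
Proof.
rewrite umap_class /=; move: (hmor_base g); move: (g 0 (base X)) => y e.
by subst y.
Qed.

Definition unfold_map : hmor (unfold X) (unfold Y) :=
  @Hmor (unfold X) (unfold Y)
    (@Pmor (unfold X) (unfold Y) umap umap_face) umap_base.

End UnfoldMap.

(* Each cube is reached by exactly one homotopy class of pointed cube paths. *)
Definition hd_tree (X : hda) : Prop :=
  forall n (x : X n), exists! u : unfold X n, proj X n u = x.

(** * Path objects and HDP *)

Definition cell (X : precubical) : Type := {n : nat & X n}.

Definition cell_map (X Y : precubical) (f : pmor X Y) (c : cell X) : cell Y :=
  existT (cube Y) (projT1 c) (f _ (projT2 c)).

Definition base_cell (X : hda) : cell X := existT (cube X) 0 (base X).

(* [is_face k nu c d]: d = delta_k^nu c *)
Definition is_face (X : precubical) (k : nat) (nu : bool) (c d : cell X) : Prop :=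
  exists n (i : 'I_n.+1) (x : X n.+1),
    [/\ i = k :> nat, c = existT (cube X) n.+1 x
      & d = existT (cube X) n (face i nu x)].

(* [iter_face [:: k1; ...; kp] [:: nu1; ...; nup] c d]:
   d = delta_k1^nu1 ... delta_kp^nup c *)
Fixpoint iter_face (X : precubical) (ks : seq nat) (nus : seq bool)
    (c d : cell X) : Prop :=
  match ks, nus with
  | [::], [::] => d = c
  | k :: ks', nu :: nus' => exists2 b, iter_face ks' nus' c b & is_face k nu b d
  | _, _ => False
  end.

Definition cube_path (X : precubical) m (x : 'I_m -> cell X) : Prop :=
  forall i j : 'I_m, j = i.+1 :> nat ->
    exists k, is_face k false (x j) (x i) \/ is_face k true (x i) (x j).

Definition path_rep (P : precubical) m (x : 'I_m -> cell P) : Prop :=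
  [/\ injective x, cube_path x
    & forall c : cell P, exists (j : 'I_m) (nus : seq bool),
        exists! ks : seq nat, sorted ltn ks /\ iter_face ks nus (x j) c].

Definition pointed_rep (P : hda) m (x : 'I_m.+1 -> cell P) : Prop :=
  path_rep x /\ x ord0 = base_cell P.

(* The tree condition makes explicit that objects of HDP are higher-dimensional
   trees.  It is not implied by [pointed_rep]: a directed cycle
   (v1,e1,v2,e2,v3,e3) with delta_1^1 e3 = v1 satisfies the latter, and its
   projection from the unfolding is not invertible. *)
Definition hdp_obj (P : hda) : Prop :=
  (exists m (x : 'I_m.+1 -> cell P), pointed_rep x) /\ hd_tree P.

Definition path_ext (P Q : hda) (f : hmor P Q) : Prop :=
  exists m q (x : 'I_m.+1 -> cell P) (y : 'I_q.+1 -> cell Q) (mq : m.+1 <= q.+1),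
    [/\ pointed_rep x, pointed_rep y
      & forall j, cell_map f (x j) = y (widen_ord mq j)].

Inductive hdp_mor : forall P Q : hda, hmor P Q -> Prop :=
| hdp_iso P Q (f : hmor P Q) : hdp_obj P -> hdp_obj Q -> hiso f -> hdp_mor f
| hdp_ext P Q (f : hmor P Q) : hdp_obj P -> hdp_obj Q -> path_ext f -> hdp_mor f
| hdp_comp P Q R (g : hmor Q R) (f : hmor P Q) (h : hmor P R) :
    hdp_mor g -> hdp_mor f -> heq h (hcomp g f) -> hdp_mor h.

(** * Bisimilarity *)

Definition hda_open (X Y : hda) (f : hmor X Y) : Prop :=
  forall (P Q : hda) (g : hmor P Q) (p : hmor P X) (q : hmor Q Y),
    hdp_mor g -> heq (hcomp f p) (hcomp q g) ->
    exists r : hmor Q X, heq (hcomp r g) p /\ heq (hcomp f r) q.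

Definition bisimilar (S : countType) (X Y : lhda S) : Prop :=
  exists (Z : lhda S) (f : hmor Z X) (g : hmor Z Y),
    [/\ heq (hcomp (hlabel X) f) (hlabel Z), hda_open f,
        heq (hcomp (hlabel Y) g) (hlabel Z) & hda_open g].

(** * Homotopy bisimilarity *)

Definition hdph_mor (P Q : hda) (h : hmor (unfold P) (unfold Q)) : Prop :=
  [/\ hdp_obj P, hdp_obj Q
    & exists2 s : hmor P (unfold P), hinverse (proj P) s
        & hdp_mor (hcomp (proj Q) (hcomp h s))].

Definition hdah_open (X Y : hda) (f : hmor (unfold X) (unfold Y)) : Prop :=
  forall (P Q : hda) (g : hmor (unfold P) (unfold Q))
         (p : hmor (unfold P) (unfold X)) (q : hmor (unfold Q) (unfold Y)),
    hdph_mor g -> heq (hcomp f p) (hcomp q g) ->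
    exists r : hmor (unfold Q) (unfold X),
      heq (hcomp r g) p /\ heq (hcomp f r) q.

Definition homotopy_bisimilar (S : countType) (X Y : lhda S) : Prop :=
  exists (Z : lhda S) (f : hmor (unfold Z) (unfold X))
         (g : hmor (unfold Z) (unfold Y)),
    [/\ heq (hcomp (unfold_map (hlabel X)) f) (unfold_map (hlabel Z)),
        hdah_open f,
        heq (hcomp (unfold_map (hlabel Y)) g) (unfold_map (hlabel Z))
      & hdah_open g].

(* Main.v *)
Require Import Defs.
From mathcomp Require Import all_boot.
From mathcomp Require Import boolp.

Set Implicit Arguments.
Unset Strict Implicit.
Unset Printing Implicit Defensive.

(** Projections of unfoldings have unique lifting along cube paths, so a
    morphism from a reachable HDA into an unfolding is determined by its
    composite with the projection.  For a tree [Q] the projection has an inverse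
    [s], so every [q : Q -> X] lifts to [unfold_map q \o s : Q -> unfold X].
    Existence and uniqueness of these lifts make projections open, and make
    [unfold_map f] open whenever [f] is.  Moreover, as objects of HDP are
    isomorphic to their unfoldings, a morphism [unfold X -> unfold Y] is open in
    HDAh iff it is open in HDA.  A span of open maps out of [Z] thus unfolds to a
    span in HDAh, and a span out of [unfold Z] in HDAh projects to a span in HDA
    with apex [unfold Z]. *)

Lemma uclass_inj (X : hda) n (x : X n) (c d : cpath x) :
  uclass c = uclass d -> homotopic c d.
Proof.
move=> E.
(* The type of [ucls u] depends on [uend u], so the claim is generalized over [u] and over the
   equation [e] that transports [d]. *)
have H (u : ucube X n) : u = uclass d ->
    forall e : x = uend u, ucls (eq_rect x (@cpath X n) d _ e).
  by move=> -> e; rewrite (Prop_irrelevance e erefl); apply: hom_refl.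
exact: H E erefl.
Qed.

(** Both cubes are classes of paths whose last step goes up along [k]; the face drops that step, and
    a homotopy between the shorter paths extends over it. *)
Lemma uface0_inj (X : hda) n (k : 'I_n.+1) (u v : ucube X n.+1) :
  uend u = uend v -> uface k false u = uface k false v -> u = v.
Proof.
have [c ->] := uclass_up_ex k u; have [d ->] := uclass_up_ex k v.
move: (uend u) (uend v) c d => x y c d exy; change (x = y) in exy; subst y.
by rewrite !uclass_up => /uclass_inj cd; apply/uclass_hom/hom_up.
Qed.

Definition reachable (P : hda) : Prop :=
  forall n (x : P n), exists u : unfold P n, proj P n u = x.

Lemma hd_tree_reachable (P : hda) : hd_tree P -> reachable P.
Proof. by move=> tP n x; have [u [ux _]] := tP n x; exists u. Qed.

(** Induction along a path to [x]: a step down to a 1-face forces the value, and [uface0_inj]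
    settles a step up. *)
Lemma unfold_lift_unique (P X : hda) (a b : hmor P (unfold X)) :
  reachable P -> heq (hcomp (proj X) a) (hcomp (proj X) b) -> heq a b.
Proof.
move=> rP ab n x; have [u <-] := rP n x.
have [c _] := uclass_ex u; move: (proj P n u : P n) (c : cpath (proj P n u)).
move=> {u c} {}x; elim=> {n x} [|n k y x e _ IH|n k x y e _ IH].
- by rewrite !hmor_base.
- apply: (uface0_inj (k := k)); first exact: ab.
  by move: IH; rewrite e !pmorP.
- by rewrite e !pmorP IH.
Qed.

(** Uniqueness of preimages makes their pointwise choice commute with faces. *)
Lemma hd_tree_section (P : hda) : hd_tree P ->
  {s : hmor P (unfold P) | hinverse (proj P) s}.
Proof.
move=> tP.
have uniq_lift n (u v : unfold P n) : proj P n u = proj P n v -> u = v.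
  by have [w [_ wP]] := tP n (proj P n v) => uv; rewrite -(wP u uv) (wP v).
have ex n (x : P n) : {u | proj P n u = x}.
  by apply: cid; apply: hd_tree_reachable.
have sK n x : proj P n (sval (ex n x)) = x := svalP (ex n x).
have sF n (k : 'I_n.+1) nu (x : P n.+1) :
    sval (ex _ (face k nu x)) = face k nu (sval (ex _ x)) :> unfold P n.
  by apply: uniq_lift; rewrite sK pmorP sK.
have sB : sval (ex 0 (base P)) = base (unfold P).
  by apply: uniq_lift; rewrite sK hmor_base.
exists (@Hmor P (unfold P) (@Pmor P (unfold P) (fun n x => sval (ex n x)) sF) sB).
by split=> n x /=; [apply: uniq_lift|]; apply: sK.
Qed.

Lemma hmor_ext (X Y : hda) (f g : hmor X Y) : heq f g -> f = g.
Proof.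
case: f g => [[f fP] fB] [[g gP] gB] fg.
have E : f = g by apply: functional_extensionality_dep => n; apply: funext => x.
subst g; have E := Prop_irrelevance fP gP; subst gP.
by rewrite (Prop_irrelevance fB gB).
Qed.

Lemma hdp_mor_obj (P Q : hda) (g : hmor P Q) :
  hdp_mor g -> hdp_obj P /\ hdp_obj Q.
Proof. by elim=> {P Q g} // P Q R g f h _ [_ oR] _ [oP _] _. Qed.

(** The classes of the prefixes of [c] form a pointed cube path to [uclass c]. *)
Lemma unfold_reachable (X : hda) : reachable (unfold X).
Proof.
move=> n u; have [c ->] := uclass_ex u; move: (uend u) c => x {u}.
elim=> {n x} [|n k y x e c [v vE]|n k x y e c [v vE]].
- by exists (base (unfold (unfold X))).
- have [d _] := uclass_ex v.
  have E : uclass c = face k false (uclass (cp_up k e c) : unfold X n.+1).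
    exact/esym/uclass_up.
  by rewrite -vE in E; exists (uclass (@cp_up (unfold X) n k _ _ E d)).
- have [d _] := uclass_ex v.
  have E : uclass (cp_down k e c) = face k true (uclass c : unfold X n.+1).
    exact/esym/uclass_down.
  by rewrite -vE in E; exists (uclass (@cp_down (unfold X) n k _ _ E d)).
Qed.

(** Both sides lift [hcomp (hcomp g f) (proj X)]. *)
Lemma unfold_map_comp (X Y Z : hda) (g : hmor Y Z) (f : hmor X Y) :
  heq (unfold_map (hcomp g f)) (hcomp (unfold_map g) (unfold_map f)).
Proof. exact: (unfold_lift_unique (@unfold_reachable X)). Qed.

Lemma proj_open (X : hda) : hda_open (proj X).
Proof.
move=> P Q g p q /hdp_mor_obj [[_ tP] [_ tQ]] sq.
have [s [_ sK]] := hd_tree_section tQ.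
have rq n x : q n (proj Q n (s n x)) = q n x by congr (q n); apply: sK.
exists (hcomp (unfold_map q) s); split=> //.
(* Both [p] and the diagonal precomposed with [g] lift [hcomp q g]. *)
apply: unfold_lift_unique (hd_tree_reachable tP) _ => n x.
by rewrite (sq n x); apply: rq.
Qed.

Lemma hda_open_comp (X Y Z : hda) (g : hmor Y Z) (f : hmor X Y) :
  hda_open g -> hda_open f -> hda_open (hcomp g f).
Proof.
move=> og of_ P Q h p q hh sq.
have [r [rh gr]] := og P Q h (hcomp f p) q hh sq.
have [t [th ft]] := of_ P Q h p r hh (fun n x => esym (rh n x)).
by exists t; split=> // n x; rewrite -gr; apply: congr1 (ft n x).
Qed.

(** Openness of [hcomp f (proj X)] yields a diagonal [r]; then [hcomp (unfold_map f) r] and [q]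
    agree because they have the same projection to [Y]. *)
Lemma unfold_map_open (X Y : hda) (f : hmor X Y) :
  hda_open f -> hda_open (unfold_map f).
Proof.
move=> of_ P Q g p q hg sq; have [[_ tP] [_ tQ]] := hdp_mor_obj hg.
have [r [rg fr]] := hda_open_comp of_ (@proj_open X) (q := hcomp (proj Y) q)
  hg (fun n x => congr1 (@uend _ n) (sq n x)).
exists r; split=> //.
exact: unfold_lift_unique (hd_tree_reachable tQ) _.
Qed.

Lemma hdah_openP (X Y : hda) (f : hmor (unfold X) (unfold Y)) :
  hdah_open f <-> hda_open f.
Proof.
split=> of_ P Q g p q hg sq.
- have [oP oQ] := hdp_mor_obj hg.
  have [sP [sPK sP']] := hd_tree_section oP.2.
  have [sQ [sQK sQ']] := hd_tree_section oQ.2.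
  (* Conjugating [g] by the isomorphisms with the unfoldings gives a morphism of HDPh, since
     conjugating back returns [g]. *)
  pose g' := hcomp sQ (hcomp g (proj P)).
  have hg' : hdph_mor g'.
    split=> //; exists sP => //.
    suff -> : hcomp (proj Q) (hcomp g' sP) = g by [].
    by apply: hmor_ext => n x; rewrite -[RHS](sQ' n) -[in RHS](sP' n x).
  have sq' : heq (hcomp f (hcomp p (proj P))) (hcomp (hcomp q (proj Q)) g').
    move=> n x; rewrite [LHS](sq n); congr (q n _); exact/esym/sQ'.
  have [r [rg fr]] := of_ P Q g' _ _ hg' sq'.
  exists (hcomp r sQ); split=> n x.
  + have /= := rg n (sP n x); rewrite [uend _](sP' n x); exact.
  + have /= := fr n (sQ n x); rewrite [uend _](sQ' n x); exact.
- case: hg => oP oQ [sP [sPK sP'] hg].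
  have [sQ [sQK sQ']] := hd_tree_section oQ.2.
  have sq' : heq (hcomp f (hcomp p sP))
                 (hcomp (hcomp q sQ) (hcomp (proj Q) (hcomp g sP))).
    by move=> n x; rewrite [LHS](sq n); congr (q n _); apply/esym/sQK.
  have [r [rg fr]] := of_ P Q _ _ _ hg sq'.
  exists (hcomp r (proj Q)); split=> n u.
  + have /= := rg n (proj P n u); rewrite [sP n _](sPK n u); exact.
  + have /= := fr n (proj Q n u); rewrite [sQ n _](sQK n u); exact.
Qed.

Theorem theorem6p8 (S : countType) (X Y : lhda S) :
  homotopy_bisimilar X Y <-> bisimilar X Y.
Proof.
split=> -[Z [f [g [lf of_ lg og]]]].
- pose Z' := @Lhda S (unfold Z) (hcomp (hlabel Z) (proj Z)).
  exists Z', (hcomp (proj X) f), (hcomp (proj Y) g); split.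
  (* The label equation in [unfold (bang S)] is projected to [bang S]. *)
  + by move=> n u; apply: (congr1 (@uend _ n) (lf n u)).
  + by apply: hda_open_comp (@proj_open X) _; apply/hdah_openP.
  + by move=> n u; apply: (congr1 (@uend _ n) (lg n u)).
  + by apply: hda_open_comp (@proj_open Y) _; apply/hdah_openP.
- exists Z, (unfold_map f), (unfold_map g); split.
  + by move=> n u; rewrite -(hmor_ext lf) unfold_map_comp.
  + exact/hdah_openP/unfold_map_open.
  + by move=> n u; rewrite -(hmor_ext lg) unfold_map_comp.
  + exact/hdah_openP/unfold_map_open.
Qed.
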